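(* The model $IBME$ provides an inner approximation of $SP$ in the sense that $\mathrm{Proj}_{nr}(XIBME)\subseteq\mathrm{Proj}_{nr}(XSP)$.
   Context: $N$ is a finite set of zones, $CNE$ a finite set of critical network elements, $PTDF_{k,z}\in\mathbb{R}$ ($k\in CNE$, $z\in N$) and $\widetilde F_k\in\mathbb{R}$ ($k\in CNE$) are given parameters. $\mathrm{Proj}_{nr}$ denotes projection on the variables $nr=(nr_z)_{z\in N}\in\mathbb{R}^N$. The models $IBME$ and $SP$ have the same objective, order-book variables and order-book constraints and differ only in that $nr$ is required to lie in $\mathrm{Proj}_{nr}(XIBME)$, respectively $\mathrm{Proj}_{nr}(XSP)$. For $l\in N$ let $V^l=\{v\in\mathbb{R}^N: v_l=-1,\ v_z\ge0\ \forall z\ne l,\ \sum_{z\in N}v_z=0\}$. $XIBME$ is the set of pairs $(nr,f)$, where $nr\in\mathbb{R}^N$ and $f=(f_{v^l})_{l\in N,\,v^l\in V^l}$ is a family of real numbers with only finitely many non-zero elements, such that $nr=\sum_{l\in N}\sum_{v^l\in V^l} f_{v^l}\,v^l$; $\sum_{l\in N}\sum_{v^l\in V^l}\max\big(0,\sum_{z\in N}PTDF_{k,z}v^l_z\big)f_{v^l}\le\widetilde F_k$ for all $k\in CNE$; $f\ge0$. $XSP$ is the set of all tuples consisting of first-stage variables $(nr_z,TRD_z,TRS_z)_{z\in N}$ and, for each scenario $s=(s_z)_{z\in N}\in\{0,1\}^{N}$, second-stage variables $(TRDAct_{z,s},TRSAct_{z,s},nrAct_{z,s})_{z\in N}$,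 all real, such that: $\sum_{z} nr_z=0$; $\sum_{z} PTDF_{k,z}\,nr_z\le \widetilde F_k$ for all $k\in CNE$; $nr_z=TRS_z-TRD_z$ for all $z$; and for every $s\in\{0,1\}^N$: $TRDAct_{z,s}=s_z\,TRD_z$, $TRSAct_{z,s}\le TRS_z$, $nrAct_{z,s}=TRSAct_{z,s}-TRDAct_{z,s}$ for all $z$; $\sum_z nrAct_{z,s}=0$; $\sum_z PTDF_{k,z}\,nrAct_{z,s}\le \widetilde F_k$ for all $k\in CNE$; and $TRS,TRD,TRSAct,TRDAct\ge 0$. *)

(* Defs.v *)
(* MathComp / MathComp-Analysis. *)
From HB Require Import structures.
From mathcomp Require Import all_boot all_order all_algebra.
From mathcomp Require Import all_classical reals.
Set Implicit Arguments.
Unset Strict Implicit.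
Unset Printing Implicit Defensive.
Import Order.TTheory GRing.Theory Num.Theory.
Local Open Scope classical_set_scope.
Local Open Scope ring_scope.

Definition Proj_nr (T U : Type) (X : set (T * U)) : set T := fst @` X.

Definition exchange_dirs (R : realType) (N : finType) (l : N) :
    set {ffun N -> R} :=
  [set v : {ffun N -> R} | v l = -1 /\ (forall z, z != l -> 0 <= v z) /\ \sum_z v z = 0].

(* A family indexed by the pairs (l, v) with v \in exchange_dirs l is encoded
   as a total function f : N -> {ffun N -> R} -> R; its values at the other
   pairs are neither used nor constrained.  The inner sums are the sums of
   finite support \sum_(v \in A) of fsbigop, which are genuine sums here thanks
   to the first condition. *)
Definition XIBME (R : realType) (N CNE : finType)
    (PTDF : CNE -> N -> R) (F : CNE -> R) :
    set ({ffun N -> R} * (N -> {ffun N -> R} -> R)) :=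
  [set x : {ffun N -> R} * (N -> {ffun N -> R} -> R) | let: (nr, f) := x in
    [/\ finite_set [set p : N * {ffun N -> R} |
                     exchange_dirs p.1 p.2 /\ f p.1 p.2 != 0],
        forall z : N,
          nr z = \sum_(l : N) \sum_(v \in exchange_dirs l) f l v * v z,
        forall k : CNE,
          \sum_(l : N) \sum_(v \in exchange_dirs l)
            Num.max 0 (\sum_(z : N) PTDF k z * v z) * f l v <= F k
      & forall (l : N) (v : {ffun N -> R}),
          exchange_dirs l v -> 0 <= f l v]].

Definition scenario (N : finType) := {ffun N -> bool}.

Record SP_vars (R : realType) (N : finType) := SPVars {
  TRD : N -> R;
  TRS : N -> R;
  TRDAct : N -> scenario N -> R;
  TRSAct : N -> scenario N -> R;
  nrAct : N -> scenario N -> R }.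

Definition XSP (R : realType) (N CNE : finType)
    (PTDF : CNE -> N -> R) (F : CNE -> R) :
    set ({ffun N -> R} * SP_vars R N) :=
  [set x : {ffun N -> R} * SP_vars R N | let: (nr, y) := x in
    [/\ \sum_(z : N) nr z = 0,
        forall k : CNE, \sum_(z : N) PTDF k z * nr z <= F k,
        forall z : N, nr z = TRS y z - TRD y z,
        forall z : N, 0 <= TRS y z /\ 0 <= TRD y z
      & forall s : scenario N,
        [/\ forall z : N,
              [/\ TRDAct y z s = (s z)%:R * TRD y z,
                  TRSAct y z s <= TRS y z
                & nrAct y z s = TRSAct y z s - TRDAct y z s],
            \sum_(z : N) nrAct y z s = 0,
            forall k : CNE, \sum_(z : N) PTDF k z * nrAct y z s <= F k
          & forall z : N, 0 <= TRSAct y z s /\ 0 <= TRDAct y z s]]].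

(* Main.v *)
Require Import Defs.
From HB Require Import structures.
From mathcomp Require Import all_boot all_order all_algebra.
From mathcomp Require Import finmap all_classical reals.
Import Order.TTheory GRing.Theory Num.Theory.
Local Open Scope classical_set_scope.
Local Open Scope ring_scope.

(** A point of the first model writes [nr] as a finite sum of exchanges: the
    exchange [v] of zone [l] withdraws [f l v] from [l] and spreads it over the
    other zones.  Let [TRD z] be the total withdrawn by the exchanges of [z]
    itself, and [TRS z] the total that [z] receives from the exchanges of the
    other zones; their difference is [nr z].

    A scenario [s] is answered by executing exactly the exchanges of the zones
    [l] with [s l].  Then a zone withdraws [TRD z] or nothing, as [s] requires;
    it receives at most [TRS z], since fewer nonnegative terms are summed; and
    the balance is zero because every direction sums to zero
    ([sum_dispatch]).  The load on a network element is a sum, over the executed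
    exchanges only, of terms each below its positive part, so it is at most the
    sum of all positive parts, which the first model bounds by the capacity
    ([dispatch_flow_le]).  Executing all the exchanges gives [nr], so the
    first-stage constraints are the case of the scenario that is true
    everywhere. *)

(** * Finitely many active exchanges *)

(** The support of a sum over [exchange_dirs l] depends on its summand.  One
    sequence per zone serves all the summands that vanish with [f], so that
    their sums can be compared termwise and exchanged with other sums. *)
Lemma active_dirs_exist (R : realType) (N : finType)
    (f : N -> {ffun N -> R} -> R) :
  finite_set [set p : N * {ffun N -> R} |
               exchange_dirs p.1 p.2 /\ f p.1 p.2 != 0] ->
  exists D : N -> seq {ffun N -> R},
    (forall l v, v \in D l -> exchange_dirs l v) /\
    (forall l (h : {ffun N -> R} -> R), (forall v, f l v = 0 -> h v = 0) ->
      \sum_(v \in exchange_dirs l) h v = \sum_(v <- D l) h v).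
Proof.
move=> finf.
pose A l := [set v | exchange_dirs l v /\ f l v != 0].
have finA l : finite_set (A l).
  apply: sub_finite_set (finite_image snd finf) => v [vl fv].
  by exists (l, v).
exists (fun l => fset_set (A l) : seq _).
have inA l v : v \in fset_set (A l) -> exchange_dirs l v.
  by rewrite in_fset_set // inE => -[].
split=> // l h h0; rewrite (@fsbigE _ _ _ _ _ (fset_set (A l))) //=.
- rewrite big_seq_cond [RHS]big_seq; apply: eq_bigl => v.
  by apply: andb_idr => /inA vl; rewrite inE.
- by move=> v /= /inA.
- move=> v vl; rewrite in_fset_set // => vA; apply: h0.
  by apply: contraNeq vA => fv; rewrite inE.
Qed.

(** * Executing the exchanges of some of the zones *)

Definition dispatch {R : realType} {N : finType} (f : N -> {ffun N -> R} -> R)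
    (D : N -> seq {ffun N -> R}) (s : pred N) (z : N) : R :=
  \sum_(l | s l) \sum_(v <- D l) f l v * v z.

Definition withdrawn {R : realType} {N : finType} (f : N -> {ffun N -> R} -> R)
    (D : N -> seq {ffun N -> R}) (z : N) : R :=
  \sum_(v <- D z) f z v.

Definition received {R : realType} {N : finType} (f : N -> {ffun N -> R} -> R)
    (D : N -> seq {ffun N -> R}) (s : pred N) (z : N) : R :=
  \sum_(l | s l && (l != z)) \sum_(v <- D l) f l v * v z.

(** The exchanges of [z] itself are the only ones that withdraw from [z], each
    with coefficient [-1]. *)
Lemma dispatchE (R : realType) (N : finType) (f : N -> {ffun N -> R} -> R)
    (D : N -> seq {ffun N -> R}) (s : pred N) (z : N) :
  (forall l v, v \in D l -> exchange_dirs l v) ->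
  dispatch f D s z = received f D s z - (s z)%:R * withdrawn f D z.
Proof.
move=> dirD; rewrite /dispatch /received.
have own : \sum_(v <- D z) f z v * v z = - withdrawn f D z.
  rewrite -sumrN; apply: eq_big_seq => v /dirD[-> _].
  by rewrite mulrN1.
case sz: (s z); first by rewrite (bigD1 z) //= own mul1r addrC.
rewrite mul0r subr0; apply: eq_bigl => l.
by case: eqP => [->|_]; rewrite ?sz // andbT.
Qed.

Lemma sum_dispatch (R : realType) (N : finType) (f : N -> {ffun N -> R} -> R)
    (D : N -> seq {ffun N -> R}) (s : pred N) :
  (forall l v, v \in D l -> exchange_dirs l v) ->
  \sum_z dispatch f D s z = 0.
Proof.
move=> dirD; rewrite exchange_big big1 //= => l _.
rewrite exchange_big big1_seq //= => v /dirD[_ [_ v0]].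
by rewrite -mulr_sumr v0 mulr0.
Qed.

Lemma withdrawn_ge0 (R : realType) (N : finType) (f : N -> {ffun N -> R} -> R)
    (D : N -> seq {ffun N -> R}) (z : N) :
  (forall l v, v \in D l -> 0 <= f l v) -> 0 <= withdrawn f D z.
Proof. by move=> f0; rewrite /withdrawn big_seq sumr_ge0 // => v /f0. Qed.

Lemma inflow_ge0 (R : realType) (N : finType) (f : N -> {ffun N -> R} -> R)
    (D : N -> seq {ffun N -> R}) (l z : N) :
  (forall l v, v \in D l -> exchange_dirs l v) ->
  (forall l v, v \in D l -> 0 <= f l v) -> l != z ->
  0 <= \sum_(v <- D l) f l v * v z.
Proof.
move=> dirD f0 lz; rewrite big_seq sumr_ge0 // => v vD.
have [_ [v0 _]] := dirD _ _ vD.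
by rewrite mulr_ge0 ?(f0 _ _ vD) // v0 // eq_sym.
Qed.

Lemma received_ge0 (R : realType) (N : finType) (f : N -> {ffun N -> R} -> R)
    (D : N -> seq {ffun N -> R}) (s : pred N) (z : N) :
  (forall l v, v \in D l -> exchange_dirs l v) ->
  (forall l v, v \in D l -> 0 <= f l v) -> 0 <= received f D s z.
Proof.
move=> dirD f0; rewrite sumr_ge0 // => l /andP[_ lz].
exact: inflow_ge0.
Qed.

Lemma received_le (R : realType) (N : finType) (f : N -> {ffun N -> R} -> R)
    (D : N -> seq {ffun N -> R}) (s : pred N) (z : N) :
  (forall l v, v \in D l -> exchange_dirs l v) ->
  (forall l v, v \in D l -> 0 <= f l v) ->
  received f D s z <= received f D predT z.
Proof.
move=> dirD f0; rewrite /received [leLHS]big_mkcondl /=.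
apply: ler_sum => l lz.
by case: ifP => // _; exact: inflow_ge0.
Qed.

(** The positive part makes the bound uniform in [s]: an exchange that relieves
    the network element may be among those not executed, so its negative load
    cannot be counted on. *)
Lemma dispatch_flow_le (R : realType) (N : finType)
    (f : N -> {ffun N -> R} -> R) (D : N -> seq {ffun N -> R}) (s : pred N)
    (p : N -> R) :
  (forall l v, v \in D l -> 0 <= f l v) ->
  \sum_z p z * dispatch f D s z
    <= \sum_l \sum_(v <- D l) Num.max 0 (\sum_z p z * v z) * f l v.
Proof.
move=> f0.
have -> : \sum_z p z * dispatch f D s z
    = \sum_(l | s l) \sum_(v <- D l) (\sum_z p z * v z) * f l v.
  under eq_bigr do rewrite mulr_sumr.
  rewrite exchange_big; apply: eq_bigr => l _ /=.
  under eq_bigr do rewrite mulr_sumr.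
  rewrite exchange_big; apply: eq_bigr => v _ /=.
  rewrite mulr_suml; apply: eq_bigr => z _.
  by rewrite mulrA mulrAC.
rewrite [leLHS]big_mkcond /=; apply: ler_sum => l _.
rewrite [leRHS]big_seq; case: ifP => _.
  by rewrite big_seq; apply: ler_sum => v /f0 fv; rewrite ler_wpM2r // le_max lexx orbT.
by rewrite sumr_ge0 // => v /f0 fv; rewrite mulr_ge0 // le_max lexx.
Qed.

(** * The inclusion *)

Theorem proposition5 (R : realType) (N CNE : finType)
    (PTDF : CNE -> N -> R) (F : CNE -> R) :
  Proj_nr (XIBME PTDF F) `<=` Proj_nr (XSP PTDF F).
Proof.
move=> _ [[nr f] [finf nrE capF fge0] <-] /=.
have [D [dirD sumD]] := active_dirs_exist _ _ _ finf.
have f0 l v : v \in D l -> 0 <= f l v by move=> /dirD; exact: fge0.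
have nr_dispatch z : nr z = dispatch f D predT z.
  rewrite nrE; apply: eq_bigr => l _.
  by apply: sumD => v ->; rewrite mul0r.
have flow_le (s : pred N) k : \sum_z PTDF k z * dispatch f D s z <= F k.
  apply: le_trans (dispatch_flow_le _ _ _ _ _ _ f0) _.
  apply: le_trans (capF k); apply: ler_sum => l _.
  by rewrite sumD // => v ->; rewrite mulr0.
pose y := SPVars (withdrawn f D) (received f D predT)
  (fun z s => (s z)%:R * withdrawn f D z)
  (fun z s => received f D s z) (fun z s => dispatch f D s z).
exists (nr, y) => //; split=> /=.
- by under eq_bigr do rewrite nr_dispatch; exact: sum_dispatch.
- by move=> k; under eq_bigr do rewrite nr_dispatch; exact: flow_le.
- by move=> z; rewrite nr_dispatch dispatchE // mul1r.
- by move=> z; split; [exact: received_ge0 | exact: withdrawn_ge0].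
- move=> s; split=> [z|||z].
  + by split; [| exact: received_le | exact: dispatchE].
  + exact: sum_dispatch.
  + by move=> k; exact: flow_le.
  + by split; [exact: received_ge0 | rewrite mulr_ge0 ?ler0n ?withdrawn_ge0].
Qed.
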